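(* Let $\alpha,\beta$ be integers, excluding the case $-\alpha=\beta>0$. There exists a 2-ary $(\alpha,\beta)$-Conolly meta-Fibonacci recursion if and only if $\beta\ge 0$, $\alpha+\beta>0$, and $\alpha$ is even.
   Context: The ruler function $r_m$ ($m\ge1$) is $1$ plus the exponent of $2$ in the prime factorization of $m$. A nondecreasing sequence of positive integers is $(\alpha,\beta)$-Conolly if for every positive integer $m$ the number of times $m$ occurs in it is $\alpha+\beta r_m$. A 2-ary meta-Fibonacci recursion (of order $p$) is a recursion $R(n)=R\big(n-s-\sum_{j=1}^p R(n-a_j)\big)+R\big(n-t-\sum_{j=1}^p R(n-b_j)\big)$ with integers $p\ge1$, $s,t\ge 0$, $a_j,b_j\ge 1$; it is $(\alpha,\beta)$-Conolly if for some choice of finitely many positive initial values $R(1),\dots,R(c)$ the recursion has a well-defined solution for all $n$ (all arguments positive) which is $(\alpha,\beta)$-Conolly. *)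

(* Defs.v *)
From mathcomp Require Import all_boot all_order all_algebra.
From mathcomp Require Import classical_sets cardinality.

Set Implicit Arguments.
Unset Strict Implicit.
Unset Printing Implicit Defensive.

Import Order.TTheory GRing.Theory Num.Theory.

Local Open Scope classical_set_scope.
Local Open Scope card_scope.
Local Open Scope nat_scope.

(* Sequences R(1), R(2), ... are functions R : nat -> nat whose value at 0
   is never used. *)

Definition ruler (m : nat) : nat := 1 + logn 2 m.

Definition conolly_seq (alpha beta : int) (R : nat -> nat) : Prop :=
  [/\ forall n, 0 < n -> 0 < R n,
      forall i j, 0 < i -> i <= j -> R i <= R j &
      forall m, 0 < m ->
        exists2 k : nat, [set n | 0 < n /\ R n = m] #= `I_k &
                         (k%:Z = alpha + beta * (ruler m)%:Z)%R].

(* R(n) = R(n - s - sum_j R(n - a_j)) + R(n - t - sum_j R(n - b_j)) *)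
Record recursion2 : Type := Recursion2 {
  rec_order : nat;
  shift_s : nat;
  shift_t : nat;
  delay_a : 'I_rec_order -> nat;
  delay_b : 'I_rec_order -> nat;
  rec_order_gt0 : 0 < rec_order;
  delay_a_gt0 : forall j, 0 < delay_a j;
  delay_b_gt0 : forall j, 0 < delay_b j }.

Definition nested (p s : nat) (a : 'I_p -> nat) (R : nat -> nat) (n : nat) :=
  s + \sum_(j < p) R (n - a j).

(* R satisfies the recursion beyond its c initial values, all inner and outer
   arguments being positive: the strict inequalities ensure that no natural
   number subtraction below is truncated. *)
Definition solution (rec : recursion2) (c : nat) (R : nat -> nat) : Prop :=
  (forall n, 0 < n <= c -> 0 < R n) /\
  (forall n, c < n ->
     [/\ forall j, @delay_a rec j < n,
         forall j, @delay_b rec j < n,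
         nested (shift_s rec) (@delay_a rec) R n < n,
         nested (shift_t rec) (@delay_b rec) R n < n &
         R n = R (n - nested (shift_s rec) (@delay_a rec) R n)
             + R (n - nested (shift_t rec) (@delay_b rec) R n)]).

Definition conolly_recursion (alpha beta : int) (rec : recursion2) : Prop :=
  exists (c : nat) (R : nat -> nat),
    solution rec c R /\ conolly_seq alpha beta R.

(* Main.v *)
(** Put [d := alpha + beta] and [b := beta], so that [m] occurs
    [d + b * logn 2 m] times, and let [N m] be the position of the last [m];
    then [N (2k) = N k + (d + b) k].

    Since [N m = (d + b) m + O(log m)], a solution satisfies
    [R n = n / (d + b) + O(log n)].  Comparing the main terms of the recursion
    gives [d + b = 2p], hence [alpha = 2p - 2b] is even.

    Conversely, if [d + b = 2p], choose delays [a_j] such that the [a_j] and the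
    [a_j + d] are [2p] distinct values in [[1, d + 2p)].  Then
    [X n := n - sum_j R (n - a_j)] runs through block [k + 1] while [n] runs
    through blocks [2k + 1] and [2k + 2], so that [R (X n)] is [R n / 2] rounded
    up.  Every block has length at least [d], the odd ones exactly [d], so
    [R (X (n - d))] is [R n / 2] rounded down, and the two add up to [R n]. *)
Require Import Defs.
From mathcomp Require Import all_boot all_order all_algebra.
From mathcomp Require Import classical_sets cardinality.
From mathcomp Require Import zify.

Import Order.TTheory GRing.Theory Num.Theory.

(** * Block lengths and the positions where blocks end *)

Definition block (d b m : nat) : nat := d + b * logn 2 m.

Definition blocksum (d b m : nat) : nat := \sum_(i < m) block d b i.+1.

Lemma blocksum0 d b : blocksum d b 0 = 0.
Proof. by rewrite /blocksum big_ord0. Qed.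

Lemma blocksumS d b m : blocksum d b m.+1 = blocksum d b m + block d b m.+1.
Proof. by rewrite /blocksum big_ord_recr. Qed.

Lemma block_odd d b k : block d b k.*2.+1 = d.
Proof.
by rewrite /block logn_coprime ?muln0 ?addn0 // coprime2n /= odd_double.
Qed.

Lemma block_double d b k : block d b k.+1.*2 = b + block d b k.+1.
Proof.
by rewrite /block -muln2 lognM // (logn_prime 2 (isT : prime 2)) /=; lia.
Qed.

Lemma blocksum_double d b k :
  blocksum d b k.*2 = blocksum d b k + (d + b) * k.
Proof.
elim: k => [|k IHk]; first by rewrite blocksum0 muln0.
by rewrite doubleS !blocksumS -doubleS block_double block_odd IHk; lia.
Qed.

Lemma blocksum_ge d b m : d * m <= blocksum d b m.
Proof.
by elim: m => [|m IHm]; rewrite ?muln0 // blocksumS mulnS /block; lia.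
Qed.

(* The defect (d + b) m - blocksum m is b times the binary digit sum of m. *)
Lemma blocksum_defect d b T m : m < 2 ^ T ->
  blocksum d b m <= (d + b) * m <= blocksum d b m + b * T.
Proof.
elim: T m => [|T IHT] m.
  by rewrite ltnS leqn0 => /eqP->; rewrite blocksum0 muln0.
rewrite expnS => m_lt.
have {m_lt IHT}/IHT : m./2 < 2 ^ T by lia.
move: m./2 (odd_double_half m) => k <-; case: (odd m).
  by rewrite add1n blocksumS block_odd blocksum_double; lia.
by rewrite add0n blocksum_double; lia.
Qed.

(** * Conolly sequences as inverses of [blocksum] *)

(** A Galois connection: for [N = blocksum d b] it encodes positivity, monotonicity and all
    multiplicities at once. *)
Definition slow_inverse (N R : nat -> nat) : Prop :=
  forall m n, 0 < n -> (R n <= m) = (n <= N m).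

Lemma slow_inverse_gt0 d b R n :
  slow_inverse (blocksum d b) R -> 0 < n -> 0 < R n.
Proof. by move=> invR n_gt0; rewrite ltnNge invR // blocksum0 -ltnNge. Qed.

Lemma slow_inverse_eq N R m n : slow_inverse N R ->
  0 < n -> (R n == m.+1) = (N m < n <= N m.+1).
Proof.
by move=> invR n_gt0; rewrite ltnNge -!invR // -ltnNge eqn_leq andbC.
Qed.

Lemma slow_inverse_exists d b : 0 < d ->
  exists R, slow_inverse (blocksum d b) R.
Proof.
move=> d_gt0.
have blocksum_mono : {homo blocksum d b : m n / m <= n}.
  by apply: homo_leq leq_trans _ => // m; rewrite blocksumS leq_addr.
have exN n : exists m, n <= blocksum d b m.
  by exists n; apply: leq_trans (blocksum_ge d b n); rewrite leq_pmull.
exists (fun n => ex_minn (exN n)) => m n n_gt0.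
case: ex_minnP => k n_le k_min; apply/idP/idP; last exact: k_min.
by move/blocksum_mono; exact: leq_trans.
Qed.

Local Open Scope classical_set_scope.
Local Open Scope card_scope.

Lemma card_eq_addn a k : [set n | a < n <= a + k] #= `I_k.
Proof.
have -> : [set n | a < n <= a + k] = addn a.+1 @` `I_k.
  apply/seteqP; split => [n /= /andP[a_lt n_le]|_ [i /= i_lt <-]]; last by lia.
  by exists (n - a.+1) => /=; lia.
by apply: inj_card_eq => i j _ _ /addnI.
Qed.

Lemma card_le_interval (A : set nat) a k c :
  A #= `I_c -> A `<=` [set n | a < n <= a + k] -> c <= k.
Proof.
move=> cardA /subset_card_le leA.
by rewrite -card_le_II -(card_le_eql cardA) -(card_le_eqr (card_eq_addn a k)).
Qed.

Lemma card_ge_interval (A : set nat) a k c :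
  A #= `I_c -> [set n | a < n <= a + k] `<=` A -> k <= c.
Proof.
move=> cardA /subset_card_le leA.
by rewrite -card_le_II -(card_le_eql (card_eq_addn a k)) -(card_le_eqr cardA).
Qed.

(** Induction on [m]. If [R n <= m.+1], all positions past [N m] up to [n] carry [m.+1], so they fit
    in one block; if [R n > m.+1], every occurrence of [m.+1] lies past [N m] and before [n]. *)
Lemma slow_inverse_of_card d b (R : nat -> nat) : 0 < d ->
  (forall n, 0 < n -> 0 < R n) ->
  (forall i j, 0 < i -> i <= j -> R i <= R j) ->
  (forall m, 0 < m -> [set n | 0 < n /\ R n = m] #= `I_(block d b m)) ->
  slow_inverse (blocksum d b) R.
Proof.
move=> d_gt0 R_gt0 R_mono cardR; elim=> [|m IHm] n n_gt0.
  by rewrite blocksum0; have := R_gt0 n n_gt0; lia.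
have cardm := cardR m.+1 isT; rewrite blocksumS.
apply/idP/idP => [Rn_le|]; last (apply: contraLR; rewrite -!ltnNge => Rn_gt).
  case: (leqP n (blocksum d b m)) => [|n_gt]; first by lia.
  suff: n - blocksum d b m <= block d b m.+1 by lia.
  apply: (card_ge_interval _ (blocksum d b m) _ _ cardm) => i /= i_in.
  have := IHm i; have := R_mono i n; lia.
have n_gt : blocksum d b m < n by have := IHm n n_gt0; lia.
suff: block d b m.+1 <= n.-1 - blocksum d b m by lia.
apply: (card_le_interval _ (blocksum d b m) _ _ cardm) => i /= [i_gt0 Ri].
have := IHm i i_gt0; have := R_mono n i n_gt0; lia.
Qed.

Lemma slow_inverse_card d b R m : slow_inverse (blocksum d b) R -> 0 < m ->
  [set n | 0 < n /\ R n = m] #= `I_(block d b m).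
Proof.
case: m => // m invR _.
suff -> : [set n | 0 < n /\ R n = m.+1] =
    [set n | blocksum d b m < n <= blocksum d b m + block d b m.+1].
  exact: card_eq_addn.
rewrite -blocksumS; apply/seteqP.
split=> n /= => [[n_gt0 Rn] | n_in].
  by rewrite -(slow_inverse_eq _ _ _ _ invR) // Rn.
have n_gt0 : 0 < n by lia.
by split=> //; apply/eqP; rewrite (slow_inverse_eq _ _ _ _ invR).
Qed.

Lemma slow_inverse_mono d b R i j :
  slow_inverse (blocksum d b) R -> 0 < i -> i <= j -> R i <= R j.
Proof.
move=> invR i_gt0 le_ij; rewrite invR //; apply: (leq_trans le_ij).
by rewrite -invR //; lia.
Qed.

Lemma conolly_blockE (alpha beta : int) (d b m : nat) :
  (beta = b%:Z)%R -> (alpha + beta = d%:Z)%R ->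
  (alpha + beta * (ruler m)%:Z = (block d b m)%:Z)%R.
Proof. by move=> -> def_d; rewrite /block /ruler; lia. Qed.

Lemma conolly_seqP (alpha beta : int) (d b : nat) R :
  0 < d -> (beta = b%:Z)%R -> (alpha + beta = d%:Z)%R ->
  conolly_seq alpha beta R <-> slow_inverse (blocksum d b) R.
Proof.
move=> d_gt0 def_b def_d; split.
  case=> R_gt0 R_mono cardR; apply: slow_inverse_of_card => // m m_gt0.
  have [k card_k def_k] := cardR m m_gt0.
  suff <- : k = block d b m by [].
  by move: def_k; rewrite (conolly_blockE _ _ _ _ _ def_b def_d) => -[].
move=> invR; split=> [n|i j|m m_gt0]; first exact: slow_inverse_gt0 invR.
  exact: slow_inverse_mono invR.
exists (block d b m); first exact: slow_inverse_card.
by rewrite (conolly_blockE _ _ _ _ _ def_b def_d).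
Qed.

(** * Growth estimates and the forced order *)

Lemma slow_inverse_approx d b R T x : 0 < d ->
  slow_inverse (blocksum d b) R -> 0 < x <= 2 ^ T ->
  x <= (d + b) * R x <= x + (d + b) + b * T.
Proof.
move=> d_gt0 invR /andP[x_gt0 x_le].
case def_m: (R x) (slow_inverse_gt0 _ _ _ _ invR x_gt0) => [//|m] _.
move/eqP: def_m; rewrite (slow_inverse_eq _ _ _ _ invR) // => /andP[m_lt x_leN].
(* Only the bound free of the exponent is used here, so any exponent above the logarithm serves. *)
have /andP[N_le _] := blocksum_defect d b _ _ (ltn_expl m.+1 (isT : 1 < 2)).
have m_ltT : m < 2 ^ T.
  have := blocksum_ge d b m; have : m <= d * m by rewrite leq_pmull.
  by lia.
have /andP[_ N_ge] := blocksum_defect d b _ _ m_ltT.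
by rewrite (leq_trans x_leN N_le) mulnS; lia.
Qed.

Lemma nested_approx d b R T n p s (a : 'I_p -> nat) : 0 < d ->
  slow_inverse (blocksum d b) R -> n <= 2 ^ T ->
  (forall j, a j < n) ->
  p * n + (d + b) * s <= (d + b) * nested s a R n + \sum_(j < p) a j
    <= p * n + (d + b) * s + p * ((d + b) + b * T).
Proof.
move=> d_gt0 invR n_le a_lt.
have approx j : n <= (d + b) * R (n - a j) + a j <= n + ((d + b) + b * T).
  have a_ltn := a_lt j.
  have : 0 < n - a j <= 2 ^ T by lia.
  by move/(slow_inverse_approx _ _ _ _ _ d_gt0 invR); lia.
rewrite /nested mulnDr big_distrr /= -addnA -big_split /=.
set S := \sum_(j < p) _.
have S_ge : p * n <= S.
  rewrite -[p in p * n]card_ord -sum_nat_const.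
  by apply: leq_sum => j _; case/andP: (approx j).
have S_le : S <= p * (n + ((d + b) + b * T)).
  rewrite -[p in p * _]card_ord -sum_nat_const.
  by apply: leq_sum => j _; case/andP: (approx j).
by move: S_le; rewrite (mulnDr p n); lia.
Qed.

Lemma expn2_gt_affine (c A B : nat) :
  exists2 T, c < 2 ^ T & A + B * T < 2 ^ T.
Proof.
set u := c + A + B.*2.
have u_lt : u < 2 ^ u by rewrite ltn_expl.
have sq_le : u.+1 * u.+1 <= 2 ^ u.*2 by rewrite -addnn expnD leq_mul.
(* With [T = 2u], [2 ^ T >= (u + 1)^2], while [A <= u] and [2B <= u]. *)
by exists u.*2; nia.
Qed.

(** At [n = 2 ^ T] the recursion forces [K + L = n] and the nested sums force [g (K + L) = 2 p n],
    both up to [O(T)]. If [g] and [2p] differed, the discrepancy would be at least [n], which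
    outgrows these errors. *)
Lemma solution_order d b rec c R : 0 < d ->
  slow_inverse (blocksum d b) R -> solution rec c R ->
  d + b = 2 * rec_order rec.
Proof.
case: rec => p s t a b' p_gt0 /= _ _ d_gt0 invR [_ /= sol].
set g := d + b.
(* [C] collects the error terms that do not depend on [T]. *)
pose C := (2 * g + 2 * p) * g + \sum_(j < p) a j + \sum_(j < p) b' j
          + g * (s + t).
have [T c_lt T_gt] := expn2_gt_affine c C ((2 * g + 2 * p) * b).
have [a_lt b_lt X_gt0 Y_gt0 Rn] := sol _ c_lt.
have K_in := nested_approx _ _ _ _ _ _ s _ d_gt0 invR (leqnn _) a_lt.
have L_in := nested_approx _ _ _ _ _ _ t _ d_gt0 invR (leqnn _) b_lt.
have approx := slow_inverse_approx _ _ _ T _ d_gt0 invR.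
set n := 2 ^ T in c_lt a_lt b_lt X_gt0 Y_gt0 Rn approx T_gt K_in L_in.
set K := nested s a R n in X_gt0 Rn K_in.
set L := nested t b' R n in Y_gt0 Rn L_in.
have X_in : 0 < n - K <= n by lia.
have Y_in : 0 < n - L <= n by lia.
have n_in : 0 < n <= n by lia.
move: (approx _ X_in) (approx _ Y_in) (approx _ n_in).
rewrite Rn mulnDr -/g => {Rn approx} X_approx Y_approx n_approx.
have g_gt0 : 0 < g by lia.
have KL_ge : g * n <= g * (K + L + 2 * (g + b * T)).
  by rewrite leq_pmul2l //; lia.
have KL_le : g * (K + L) <= g * (n + 2 * (g + b * T)).
  by rewrite leq_pmul2l //; lia.
rewrite -/g in K_in L_in.
rewrite /C {C} in T_gt.
case: (ltngtP g (2 * p)) => // [g_lt | g_gt].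
  have : g.+1 * n <= (2 * p) * n by rewrite leq_mul2r g_lt orbT.
  by lia.
have : (2 * p).+1 * n <= g * n by rewrite leq_mul2r g_gt orbT.
by lia.
Qed.

(** * Distinct delays *)

(* The values are runs of d consecutive integers separated by gaps of length d,
   which the shift by d fills. *)
Definition delay (d j : nat) : nat := (j + d * (j %/ d)).+1.

Definition delays (d p : nat) : seq nat :=
  map (delay d) (iota 0 p) ++ map (fun j => delay d j + d) (iota 0 p).

Lemma delay_bounds d j p : j < p -> 0 < delay d j < p.*2.
Proof.
move=> j_lt; rewrite /delay mulnC.
by have := leq_divM j d; move: (_ %/ _ * _) => x; lia.
Qed.

Lemma delays_bounds d p v : v \in delays d p -> 0 < v < d + p.*2.
Proof.
rewrite mem_cat => /orP[] /mapP[j]; rewrite mem_iota add0n /= => j_lt ->.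
  by have := delay_bounds d _ _ j_lt; lia.
by have := delay_bounds d _ _ j_lt; lia.
Qed.

(** After subtracting 1, a [delay] has even quotient by [d] and its shift an odd one, so the two
    halves of the list are disjoint; quotient and remainder together recover [j]. *)
Lemma delays_uniq d p : 0 < d -> uniq (delays d p).
Proof.
move=> d_gt0.
have delayE j : delay d j = ((j %/ d).*2 * d + j %% d).+1.
  by rewrite /delay {1}(divn_eq j d); lia.
have delay_div j : (delay d j).-1 %/ d = (j %/ d).*2.
  by rewrite delayE /= divnMDl // (divn_small (ltn_pmod j d_gt0)) addn0.
have delay_mod j : (delay d j).-1 %% d = j %% d.
  by rewrite delayE /= modnMDl modn_mod.
have delay_inj : injective (delay d).
  move=> i j eq_ij; rewrite (divn_eq i d) (divn_eq j d).
  have := delay_div i; have := delay_mod i.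
  by rewrite eq_ij delay_mod delay_div => -> /double_inj->.
rewrite /delays cat_uniq !map_inj_uniq ?iota_uniq //= ?andbT; last first.
  by move=> i j /addIn/delay_inj.
apply/hasPn => _ /mapP[i _ ->]; apply/mapP => -[j _ eq_ij].
have pred_shift : (delay d i + d).-1 = (delay d i).-1 + d.
  by rewrite /delay addSn.
have := delay_div j; rewrite -eq_ij pred_shift.
by rewrite divnDr // delay_div divnn d_gt0; lia.
Qed.

(** Pigeonhole among the positive integers below [i]. *)
Lemma count_delays_lt d p i :
  0 < d -> 0 < i -> count (fun v => v < i) (delays d p) < i.
Proof.
move=> d_gt0 i_gt0; rewrite -size_filter -[ltnRHS](prednK i_gt0) ltnS.
rewrite -[leqRHS](size_iota 1); apply: uniq_leq_size.
  by rewrite filter_uniq ?delays_uniq.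
by move=> v; rewrite mem_filter mem_iota => /andP[v_lt /delays_bounds]; lia.
Qed.

(** Pigeonhole from the other end: the delays that are at least [i] are distinct and lie below [l],
    which will be the length of a pair of blocks. *)
Lemma count_delays_ge d p i l : 0 < d -> i <= l -> d + p.*2 <= l ->
  p.*2 + i <= l + count (fun v => v < i) (delays d p).
Proof.
move=> d_gt0 i_le l_ge.
have <- : size (delays d p) = p.*2.
  by rewrite size_cat !size_map size_iota addnn.
rewrite -(count_predC (fun v => v < i)) -addnA [l + _]addnC leq_add2l.
rewrite addnC -leq_subRL //.
rewrite -size_filter -[leqRHS](size_iota i); apply: uniq_leq_size.
  by rewrite filter_uniq ?delays_uniq.
by move=> v; rewrite mem_filter mem_iota /= => /andP[v_ge /delays_bounds]; lia.
Qed.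

Lemma count_delaysE d p i : count (fun v => v < i) (delays d p) =
  \sum_(j < p) ((delay d j < i) + (delay d j + d < i)).
Proof.
have count_ord (P : pred nat) : count P (iota 0 p) = \sum_(j < p) P j.
  rewrite -(big_mkord xpredT (fun j => nat_of_bool (P j))) /index_iota subn0.
  by rewrite -sum1_count big_mkcond; apply: eq_bigr => j _; case: (P j).
by rewrite count_cat !count_map !count_ord big_split.
Qed.

(** * Solving the constructed recursion *)

Section Solution.

Variables (d b p : nat) (R : nat -> nat).
Hypotheses (d_gt0 : 0 < d) (dbE : d + b = p.*2).
Hypothesis invR : slow_inverse (blocksum d b) R.

Local Notation N := (blocksum d b).

Lemma blocksum_bracket n : N 2 < n ->
  exists2 k, 0 < k & N k.*2 < n <= N k.+1.*2.
Proof.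
move=> n_gt; have n_gt0 : 0 < n by lia.
have Rn_gt : 2 < R n by rewrite ltnNge invR // -ltnNge.
exists (R n).-1./2; first by lia.
by rewrite ltnNge -!invR // -ltnNge; lia.
Qed.

Lemma blocksum_double_step k : N k.*2.+1 = N k.*2 + d.
Proof. by rewrite blocksumS block_odd. Qed.

(** Since [k > 0], block [2k] has length at least [d + b = 2p], more than any delay, so the argument
    stays in blocks [2k] to [2k+2]; each indicator records passing the start of one of the last
    two. *)
Lemma slow_inverse_delay n k j : 0 < k -> N k.*2 < n <= N k.+1.*2 -> j < p ->
  R (n - delay d j) =
    k.*2 + ((delay d j < n - N k.*2) + (delay d j + d < n - N k.*2)).
Proof.
case: k => // k _ /andP[n_gt n_le] /(delay_bounds d) a_bounds.
have eqR m : N m < n - delay d j <= N m.+1 -> R (n - delay d j) = m.+1.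
  by move=> N_in; apply/eqP; rewrite (slow_inverse_eq _ _ _ _ invR) //; lia.
have := blocksumS d b k.*2.+1; rewrite -doubleS block_double => N_even.
have N_odd := blocksum_double_step k.+1.
have d_le : d <= block d b k.+1 by exact: leq_addr.
have N_gt : N k.*2.+1 < n - delay d j by lia.
case: (ltnP (delay d j) (n - N k.+1.*2)) => delay1 /=; last first.
  by rewrite (eqR k.*2.+1) -?doubleS; lia.
case: (ltnP (delay d j + d) (n - N k.+1.*2)) => delay2 /=.
  by rewrite (eqR k.+1.*2.+1) -?doubleS; lia.
by rewrite (eqR k.+1.*2) -?doubleS; lia.
Qed.

(* n - X advances with n, except for a pause at each delay after the end of a
   block; as the 2p pauses in the pair of blocks 2k+1, 2k+2 are distinct, it
   stays in block k+1. *)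
Lemma slow_inverse_halve n (X := \sum_(j < p) R (n - delay d j)) : N 2 < n ->
  X < n /\ R (n - X) = uphalf (R n).
Proof.
case/blocksum_bracket => k k_gt0 n_in.
set i := n - N k.*2; set g := count (fun v => v < i) (delays d p).
have XE : X = p * k.*2 + g.
  have delayE (j : 'I_p) := slow_inverse_delay _ _ _ k_gt0 n_in (ltn_ord j).
  rewrite /X (eq_bigr _ (fun j _ => delayE j)).
  by rewrite big_split /= sum_nat_const card_ord -count_delaysE.
have := blocksum_double d b k; have := blocksum_double d b k.+1.
rewrite dbE => Nk1 Nk.
have L_ge : d + p.*2 <= N k.+1.*2 - N k.*2.
  by rewrite doubleS !blocksumS -doubleS block_odd block_double /block; lia.
have i_le : i <= N k.+1.*2 - N k.*2 by lia.
have g_lt : g < i by apply: count_delays_lt => //; lia.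
have g_ge := count_delays_ge _ _ _ _ d_gt0 i_le L_ge; rewrite -/g in g_ge.
have n_gt0 : 0 < n by lia.
(* As [N (2k) = N k + 2pk], here [n - X = N k + (i - g)]; the two pigeonhole bounds place [i - g]
   within block [k+1]. *)
have X_in : N k < n - X <= N k.+1 by rewrite XE /i in g_ge g_lt *; nia.
split; first by lia.
have -> : R (n - X) = k.+1.
  by apply/eqP; rewrite (slow_inverse_eq _ _ _ _ invR) //; lia.
have : k.*2 < R n <= k.+1.*2 by rewrite ltnNge !invR // -ltnNge.
by lia.
Qed.

(** Going back by [d] leads from block [2k+1] into block [2k], and from block [2k+2] no further than
    block [2k+1]. *)
Lemma slow_inverse_shift n : N 2 + d < n -> uphalf (R (n - d)) = (R n)./2.
Proof.
move=> n_gt; have n_gt2 : N 2 < n by lia.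
have [k k_gt0 /andP[n_gtk n_le]] := blocksum_bracket _ n_gt2.
have nd_gt0 : 0 < n - d by lia.
have n_gt0 : 0 < n by lia.
have N_odd := blocksum_double_step k.
have := invR k.*2 n n_gt0; have := invR k.*2.+1 n n_gt0.
have := invR k.+1.*2 n n_gt0; have := invR k.*2 _ nd_gt0.
have := invR k.*2.-1 _ nd_gt0; have := invR k.+1.*2 _ nd_gt0.
have k2_gt0 : 0 < k.*2 by lia.
have := blocksumS d b k.*2.-1; rewrite prednK //.
have : d <= block d b k.*2 by exact: leq_addr.
by lia.
Qed.

(** The initial segment ends at [N 2 + d] so that halving applies at both [n] and [n - d]. *)
Lemma slow_inverse_solution (p_gt0 : 0 < p) :
  solution (@Recursion2 p 0 d (fun j => delay d j) (fun j => delay d j + d)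
    p_gt0 (fun _ => isT) (fun _ => isT)) (N 2 + d) R.
Proof.
split=> [n /andP[n_gt0 _] | n n_gt]; first exact: slow_inverse_gt0 invR n_gt0.
have N2E : N 2 = d + p.*2.
  rewrite !blocksumS blocksum0 (block_double d b 0) !(block_odd d b 0).
  by lia.
have n_gt2 : N 2 < n by lia.
have nd_gt2 : N 2 < n - d by lia.
have [X_lt RX] := slow_inverse_halve n n_gt2.
have := slow_inverse_halve _ nd_gt2.
(* The second nested call at [n] is the first one at [n - d]. *)
under eq_bigr do rewrite -subnDA addnC.
rewrite slow_inverse_shift // => -[Y_lt RY].
rewrite /nested add0n subnDA RX RY; split=> [j|j|//||] /=.
- by case: j => /= j /(delay_bounds d); lia.
- by case: j => /= j /(delay_bounds d); lia.
- by rewrite -ltn_subRL.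
- by rewrite uphalf_half; have := odd_double_half (R n); lia.
Qed.

End Solution.

(** * Sign conditions and the equivalence *)

Lemma conolly_seq_positive (alpha beta : int) R :
  ~ (- alpha = beta /\ 0 < beta)%R ->
  conolly_seq alpha beta R -> (0 <= beta /\ 0 < alpha + beta)%R.
Proof.
move=> hne [R_gt0 _ cardR].
have card_ge0 i : (0 <= alpha + beta * (i.+1)%:Z)%R.
  have [|k _] := cardR (2 ^ i); first by rewrite expn_gt0.
  by rewrite /ruler pfactorK // => <-.
(* If [beta] were negative, [2 ^ |alpha|] would have multiplicity at most
   [alpha - |alpha| - 1 < 0]. *)
have beta_ge0 : (0 <= beta)%R by have := card_ge0 `|alpha|%N; nia.
have ab_ge0 : (0 <= alpha + beta)%R by have := card_ge0 0; lia.
split=> //; rewrite lt_neqAle ab_ge0 andbT; apply/eqP => ab0.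
have beta0 : (beta = 0)%R by lia.
have alpha0 : (alpha = 0)%R by lia.
(* With both parameters zero, the value [R 1] would occur nowhere. *)
have [k card_k] := cardR (R 1) (R_gt0 1 isT).
rewrite alpha0 beta0 mul0r addr0 => -[k0].
move: card_k; rewrite k0 II0 card_eq0 => /eqP R1_set0.
by have : [set n | 0 < n /\ R n = R 1] 1 by []; rewrite R1_set0.
Qed.

Local Close Scope card_scope.
Local Close Scope classical_set_scope.
Local Open Scope ring_scope.

Theorem theorem4p1 (alpha beta : int)
  (hne : ~ (- alpha = beta /\ 0 < beta)) :
  (exists rec : recursion2, conolly_recursion alpha beta rec) <->
  [/\ 0 <= beta, 0 < alpha + beta & (2 %| alpha)%Z].
Proof.
have natP (z : int) : 0 <= z -> exists n : nat, z = n%:Z.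
  by case: z => // n _; exists n.
split=> [[rec [c [R [sol seqR]]]] | [beta_ge0 ab_gt0 alpha_even]].
  have [beta_ge0 ab_gt0] := conolly_seq_positive _ _ _ hne seqR.
  have [d def_d] := natP _ (ltW ab_gt0); have [b def_b] := natP _ beta_ge0.
  have d_gt0 : (0 < d)%N by lia.
  have invR := (conolly_seqP _ _ _ _ R d_gt0 def_b def_d).1 seqR.
  by split=> //; have := solution_order _ _ _ _ _ d_gt0 invR sol; lia.
have [d def_d] := natP _ (ltW ab_gt0); have [b def_b] := natP _ beta_ge0.
have d_gt0 : (0 < d)%N by lia.
have [p dbE] : exists p, (d + b)%N = p.*2 by exists (d + b)./2; lia.
have p_gt0 : (0 < p)%N by lia.
have [R invR] := slow_inverse_exists d b d_gt0.
do 3 eexists; split.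
  exact: (slow_inverse_solution _ _ _ _ d_gt0 dbE invR p_gt0).
exact: (conolly_seqP _ _ _ _ R d_gt0 def_b def_d).2 invR.
Qed.
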